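(* Let $D$ be a Dyck path with area sequence $[c_0,\dots,c_N]$ and let $j$ be an integer. Then $D$ has a rectangle at $(i+1,j)$ for some $i$ if and only if $\mathrm{LK}(D)$ has a return at position $j+1$ which is not the final step of a $1$-hill; moreover, whenever $D$ has a rectangle at $(i+1,j)$, one has $j+1=i+c_i$.
   Context: Lattice paths use horizontal steps $(x,y)\to(x,y+1)$ and vertical steps $(x,y)\to(x+1,y)$. A Dyck path of semilength $N$ goes from $(0,0)$ to $(N,N)$ staying in $y\ge x$; its area sequence is $c_k=h_k-k+1$ ($0\le k\le N$), where $h_k$ is the largest $y$ with $(k,y)$ on the path. A valley at $(x,y)$ is a vertical step ending at $(x,y)$ immediately followed by a horizontal step. A rectangle at $(i+1,j)$ is a valley at $(i+1,j)$ such that the next valley of the path (if any) has $x$-coordinate strictly larger than $j+1$. A return at position $p$ is a vertical step with final point $(p,p)$. A $1$-hill at position $q$ is the pair of steps $(q,q)\to(q,q+1)\to(q+1,q+1)$; its final step is the vertical one. A double rise with midpoint $(x,y)$: consecutive horizontal steps $(x,y-1)\to(x,y)\to(x,y+1)$; a double fall with midpoint $(x,y)$: consecutive vertical steps $(x-1,y)\to(x,y)\to(x+1,y)$. Lalanne–Kreweras involution: if $r_1<\dots<r_m$ are the $y$-coordinates of the midpoints of the double rises of $D$ and $f_1<\dots<f_m$ the $x$-coordinates of the midpoints of its double falls, then $\mathrm{LK}(D)$ is the unique Dyck path of semilength $N$ whose valleys are exactly $(r_t,f_t)$, $1\le t\le m$. *)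

(* Defs.v *)
From HB Require Import structures.
From mathcomp Require Import all_boot all_order all_algebra.

Set Implicit Arguments.
Unset Strict Implicit.
Unset Printing Implicit Defensive.

Import Order.TTheory GRing.Theory Num.Theory.
Local Open Scope ring_scope.

(* A lattice path from (0, 0) is a word of steps: [true] is the horizontal    *)
(* step (x, y) -> (x, y + 1), [false] the vertical step (x, y) -> (x + 1, y). *)
Definition move (p : int * int) (s : bool) : int * int :=
  if s then (p.1, p.2 + 1) else (p.1 + 1, p.2).

Definition points (w : seq bool) : seq (int * int) :=
  (0, 0) :: scanl move (0, 0) w.

Definition is_dyck (N : nat) (w : seq bool) : bool :=
  (last (0, 0) (points w) == (N%:Z, N%:Z)) && all (fun p => p.1 <= p.2) (points w).

Record dyck (N : nat) := Dyck {
  dyck_word :> (N.*2).-tuple bool;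
  _ : is_dyck N dyck_word
}.

HB.instance Definition _ (N : nat) := [isSub for @dyck_word N].
HB.instance Definition _ (N : nat) := [Finite of dyck N by <:].

(* The default value 0 is harmless: all ordinates on a path are nonnegative.  *)
Definition height (w : seq bool) (k : int) : int :=
  \big[Num.max/0]_(p <- points w | p.1 == k) p.2.

(* The area sequence of a path of semilength N is its values at 0 <= k <= N.  *)
Definition area (w : seq bool) (k : int) : int := height w k - k + 1.

Definition valley (w : seq bool) (x y : int) : bool :=
  infix [:: (x - 1, y); (x, y); (x, y + 1)] (points w).

Definition valleys (w : seq bool) : seq (int * int) :=
  [seq p <- points w | valley w p.1 p.2].

Definition next_valley (w : seq bool) (v v' : int * int) : bool :=
  infix [:: v; v'] (valleys w).

Definition rectangle (w : seq bool) (x y : int) : Prop :=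
  valley w x y /\
  forall x' y' : int, next_valley w (x, y) (x', y') -> y + 1 < x'.

Definition return_at (w : seq bool) (p : int) : bool :=
  infix [:: (p - 1, p); (p, p)] (points w).

Definition one_hill (w : seq bool) (q : int) : bool :=
  infix [:: (q, q); (q, q + 1); (q + 1, q + 1)] (points w).

Definition ends_one_hill (w : seq bool) (p : int) : Prop :=
  exists2 q : int, one_hill w q & p = q + 1.

Definition double_rise (w : seq bool) (x y : int) : bool :=
  infix [:: (x, y - 1); (x, y); (x, y + 1)] (points w).

Definition double_fall (w : seq bool) (x y : int) : bool :=
  infix [:: (x - 1, y); (x, y); (x + 1, y)] (points w).

(* Midpoints are met along the path by strictly increasing y (for double      *)
(* rises) or x (for double falls), so these lists are r_1 < ... < r_m and     *)
(* f_1 < ... < f_m; on a Dyck path they have the same length.                 *)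
Definition rises (w : seq bool) : seq int :=
  [seq p.2 | p <- points w & double_rise w p.1 p.2].

Definition falls (w : seq bool) : seq int :=
  [seq p.1 | p <- points w & double_fall w p.1 p.2].

(* Exactly one E satisfies the condition, so the default D is never used.     *)
Definition LK (N : nat) (D : dyck N) : dyck N :=
  odflt D [pick E : dyck N | perm_eq (valleys E) (zip (rises D) (falls D))].

(* Main.v *)
Require Import Defs.
From mathcomp Require Import all_boot all_order all_algebra.
From mathcomp Require Import zify.
Import Order.TTheory GRing.Theory Num.Theory.
Set Implicit Arguments.
Unset Strict Implicit.
Unset Printing Implicit Defensive.
Local Open Scope nat_scope.

(** Let D have valleys (a_t, b_t), and let A and B be the sets of their x- and
    y-coordinates.  The double rises of D sit at the heights in
    [1, N-1] \ B and its double falls at the abscissas in [1, N-1] \ A, so LK(D)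
    has a valley at (p, p) iff p lies in neither A nor B and both sets have
    the same number of elements below p.  As a_t <= b_t, always
    #{a < p} >= #{b < p}; hence for 0 <= p <= N the path LK(D) meets the
    diagonal at p iff #{a <= p} = #{b < p}.  A valley of D at height j is a
    rectangle iff #{a <= j + 1} = #{b <= j}, i.e. iff LK(D) meets the diagonal
    at j + 1; and given this, j belongs to B iff LK(D) avoids the diagonal
    at j, i.e. iff the return at j + 1 does not close a 1-hill. *)

(** * Counting the elements of a list below a bound *)

Definition count_lt (p : nat) (s : seq nat) : nat := count (fun x => x < p) s.

Lemma count_ltS p s : uniq s -> count_lt p.+1 s = count_lt p s + (p \in s).
Proof.
rewrite /count_lt; elim: s => //= x s IH /andP[xs us].
rewrite IH // in_cons ltnS; move: xs.
case: (ltngtP x p) => [||->] // /negPf; lia.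
Qed.

Lemma leq_count_lt p q s : p <= q -> count_lt p s <= count_lt q s.
Proof. by move=> pq; apply: sub_count => x /= xp; apply: leq_trans xp pq. Qed.

(** In a strictly increasing list the elements below [p] form an initial segment, of length
    [count_lt p s]. *)
Lemma nth_ltn_sorted p s t : sorted ltn s -> t < size s ->
  (nth 0 s t < p) = (t < count_lt p s).
Proof.
rewrite /count_lt; elim: s t => //= x s IH t xs.
have ss := path_sorted xs.
have alls : all (ltn x) s by apply: (order_path_min ltn_trans).
case: t => [|t] /=.
  move=> _; case: ltnP => // px; rewrite add0n; apply/esym/negbTE.
  rewrite -has_count; apply/hasPn => y ys.
  by move/allP: alls => /(_ y ys) /=; lia.
rewrite ltnS => ts; rewrite (IH t ss ts).
case: (ltnP x p) => px /=; first by rewrite add1n ltnS.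
have -> : count (fun x0 => x0 < p) s = 0; last by [].
apply/eqP; rewrite -leqn0 leqNgt -has_count; apply/hasPn => y ys.
by move/allP: alls => /(_ y ys) /=; lia.
Qed.

(** Being equal to [p] means being below [p.+1] but not below [p], so [nth_ltn_sorted] is applied at
    both bounds. Positions in sorted lists thereby become counts. *)
Lemma nth_eq_sorted p s t : sorted ltn s -> t < size s ->
  (nth 0 s t == p) = (p \in s) && (count_lt p s == t).
Proof.
move=> ss ts; have us : uniq s by move: ss; rewrite ltn_sorted_uniq_leq => /andP[].
have := count_ltS p us.
have := nth_ltn_sorted p ss ts; have := nth_ltn_sorted p.+1 ss ts.
rewrite ltnS; case: (p \in s); lia.
Qed.

Lemma count_lt_iota p N : 0 < p <= N -> count_lt p (iota 1 N.-1) = p.-1.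
Proof.
move=> /andP[p0 pN].
have -> : N.-1 = p.-1 + (N - p) by lia.
rewrite /count_lt iotaD count_cat.
have -> : count (fun x => x < p) (iota 1 p.-1) = p.-1.
  rewrite -[RHS](size_iota 1) -count_predT; apply: eq_in_count => x /=.
  by rewrite mem_iota; lia.
have -> : count (fun x => x < p) (iota (1 + p.-1) (N - p)) = 0; last by lia.
apply/eqP; rewrite -leqn0 leqNgt -has_count; apply/hasPn => x.
by rewrite mem_iota; lia.
Qed.

(** * Complementary lists in [1, N-1] *)

Section Complement.

Variables (N : nat) (s c : seq nat).
Hypothesis sc : perm_eq (s ++ c) (iota 1 N.-1).

Lemma mem_complement p : 0 < p < N -> (p \in c) = (p \notin s).
Proof.
move=> pN; have pi : p \in iota 1 N.-1 by rewrite mem_iota; lia.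
have := pi; rewrite -(perm_mem sc) mem_cat.
have : uniq (s ++ c) by rewrite (perm_uniq sc) iota_uniq.
rewrite cat_uniq => /and3P[_ /hasPn h _].
case: (boolP (p \in c)) => [/h /= ->|]; rewrite ?orbF //.
by move=> _ ->.
Qed.

Lemma complement_range p : p \in c -> 0 < p < N.
Proof.
move=> pc; have : p \in s ++ c by rewrite mem_cat pc orbT.
by rewrite (perm_mem sc) mem_iota; lia.
Qed.

Lemma complemented_range p : p \in s -> 0 < p < N.
Proof.
move=> ps; have : p \in s ++ c by rewrite mem_cat ps.
by rewrite (perm_mem sc) mem_iota; lia.
Qed.

Lemma count_lt_complement p : 0 < p <= N -> count_lt p s + count_lt p c = p.-1.
Proof.
move=> pN; rewrite -(count_lt_iota pN) /count_lt -count_cat.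
by apply/permP.
Qed.

End Complement.

(** * Counting criteria for rectangles and for contacts with the diagonal *)

Section Valleys.

Variables (N : nat) (V : seq (nat * nat)) (r f : seq nat).
Local Notation A := (unzip1 V).
Local Notation B := (unzip2 V).
Hypothesis Br : perm_eq (B ++ r) (iota 1 N.-1).
Hypothesis Af : perm_eq (A ++ f) (iota 1 N.-1).
Hypotheses (sA : sorted ltn A) (sB : sorted ltn B).
Hypotheses (sr : sorted ltn r) (sf : sorted ltn f).
Hypothesis AB : all (fun v => v.1 <= v.2) V.

Lemma count_lt_valleys p : count_lt p B <= count_lt p A.
Proof.
rewrite /count_lt !count_map; elim: V AB => //= v V' IH /andP[v12 /IH] /=.
by clear - v12; lia.
Qed.

Lemma size_rises_falls : size r = size f.
Proof.
have := perm_size Br; have := perm_size Af.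
by rewrite !size_cat !size_map => <- /addnI.
Qed.

(** Passing to complements reverses [count_lt_valleys]: below any bound in [1, N] there are at least
    as many rises as falls. At the bound f_t + 1 there are more than t falls, hence more than t
    rises. This puts the points (r_t, f_t) weakly above the diagonal. *)
Lemma rises_le_falls t : t < size r -> nth 0 r t <= nth 0 f t.
Proof.
move=> tr; have tf : t < size f by rewrite -size_rises_falls.
have /(complement_range Af) fN := mem_nth 0 tf.
have := nth_ltn_sorted (nth 0 f t).+1 sr tr.
have := nth_ltn_sorted (nth 0 f t).+1 sf tf.
have : 0 < (nth 0 f t).+1 <= N by case/andP: fN.
move=> /[dup] /(count_lt_complement Br) + /(count_lt_complement Af).
have := count_lt_valleys (nth 0 f t).+1.
rewrite !ltnS leqnn => le_BA <- e /esym t_lt ->.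
by apply: leq_trans t_lt _; rewrite -(leq_add2l (count_lt (nth 0 f t).+1 B)) -e leq_add2r.
Qed.

Let uA : uniq A.
Proof. by move: sA; rewrite ltn_sorted_uniq_leq => /andP[]. Qed.

Let uB : uniq B.
Proof. by move: sB; rewrite ltn_sorted_uniq_leq => /andP[]. Qed.

Lemma mem_zip_diag p : 0 < p < N ->
  ((p, p) \in zip r f) = (count_lt p.+1 A == count_lt p B).
Proof.
move=> pN; have pN' : 0 < p <= N by case/andP: pN => -> /ltnW.
have := count_ltS p uA; have := count_ltS p uB.
have := count_lt_valleys p; have := count_lt_valleys p.+1.
have := count_lt_complement Br pN'; have := count_lt_complement Af pN'.
have := mem_complement Br pN; have := mem_complement Af pN.
move=> pf pr e1 e2 l1 l2 e3 e4.
(* Since #{b < p} <= #{a < p} <= #{a <= p}, equality of the outer counts excludes p from A. It also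
   excludes p from B, because #{b <= p} <= #{a <= p}. The equality that remains passes to the
   complements [r] and [f], where it says that p has the same index in both. *)
have -> : (count_lt p.+1 A == count_lt p B) =
  [&& p \in r, p \in f & count_lt p r == count_lt p f].
  rewrite pf pr; case: (p \in A) e4; case: (p \in B) e3 => /=;
    by clear - e1 e2 l1 l2; lia.
apply/idP/and3P => [/(nthP (0, 0))[t]|[hr hf /eqP e]].
  rewrite size_zip -size_rises_falls minnn => tr.
  rewrite nth_zip ?size_rises_falls // => -[/eqP + /eqP].
  rewrite nth_eq_sorted // nth_eq_sorted -?size_rises_falls //.
  by move=> /andP[-> /eqP->] /andP[-> /eqP->].
have /(nthP 0)[t tr rt] := hr.
have tf : t < size f by rewrite -size_rises_falls.
have tE : count_lt p r = t.
  by move/eqP: rt; rewrite nth_eq_sorted // => /andP[_ /eqP].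
have ft : nth 0 f t = p.
  by apply/eqP; rewrite nth_eq_sorted // hf -e tE eqxx.
apply/(nthP (0, 0)); exists t; last by rewrite nth_zip ?size_rises_falls ?rt ?ft.
by rewrite size_zip -size_rises_falls minnn.
Qed.

(** The contacts of LK(D) with the diagonal: the two endpoints, and in between the valleys on the
    diagonal. *)
Definition diagonal p := [|| p == 0, p == N | (p, p) \in zip r f].

(** The criterion of [mem_zip_diag] extends to the endpoints: at 0 both counts vanish, and at N both
    equal the number of valleys. *)
Lemma diagonalE p : p <= N -> diagonal p = (count_lt p.+1 A == count_lt p B).
Proof.
have BN x : x \in B -> 0 < x < N by move/(complemented_range Br).
have AN x : x \in A -> 0 < x < N by move/(complemented_range Af).
rewrite /diagonal => pN; have [->|p0] := eqVneq p 0 => /=.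
  apply/esym/eqP; transitivity 0; first apply/eqP; last apply/esym/eqP;
    rewrite /count_lt -leqn0 leqNgt -has_count; apply/hasPn => x.
    by move/AN; lia.
  by move/BN; lia.
have [->|pN'] := eqVneq p N => /=; last by rewrite mem_zip_diag //; lia.
have cA : count_lt N.+1 A = size A.
  by apply/eqP; rewrite /count_lt -all_count; apply/allP => x /AN; lia.
have cB : count_lt N B = size B.
  by apply/eqP; rewrite /count_lt -all_count; apply/allP => x /BN; lia.
by rewrite cA cB !size_map eqxx.
Qed.

Lemma rectangle_diagonal j :
  (exists2 t, t < size V & nth 0 B t = j /\ (t.+1 < size V -> j.+1 < nth 0 A t.+1))
  <-> [/\ j < N, diagonal j.+1 & ~~ diagonal j].
Proof.
have sAV : size A = size V by rewrite size_map.
have sBV : size B = size V by rewrite size_map.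
have := count_lt_valleys j.+1; have := leq_count_lt A (leqnSn j.+1).
have := count_ltS j uB => e l1 l2.
(* If j were not in B, then #{b < j} = #{b <= j} <= #{a <= j} <= #{a <= j + 1}. A contact at j + 1
   makes the outer terms equal and would thus force a contact at j. If j is in B, then #{b < j} is
   strictly smaller than #{a <= j}. *)
have -> : [/\ j < N, diagonal j.+1 & ~~ diagonal j] <->
    j \in B /\ count_lt j.+2 A = count_lt j.+1 B.
  split=> [[jN]|[jB e1]].
    rewrite (diagonalE jN) (diagonalE (ltnW jN)) => /eqP e1 /eqP ne.
    by case: (j \in B) e => e; [split | clear - e e1 ne l1 l2; lia].
  have /andP[_ jN] := complemented_range Br jB.
  rewrite (diagonalE jN) (diagonalE (ltnW jN)) e1 eqxx; rewrite jB in e.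
  by split=> //; clear - e l2; lia.
(* The index of j in B is t = #{b < j}, so #{b <= j} = t + 1. The condition on the next valley says
   that at most t + 1 elements of A are <= j + 1; for the last valley this is the bound by the size
   of A. *)
split=> [[t tV [Bt At]]|[jB e1]].
  move/eqP: Bt; rewrite nth_eq_sorted ?sBV // => /andP[jB /eqP cj].
  rewrite jB in e *; split=> //.
  have [tV'|tV'] := ltnP t.+1 (size V).
    have := nth_ltn_sorted j.+2 sA; rewrite sAV => /(_ _ tV'); have := At tV'.
    by clear - e cj l1 l2; lia.
  have : count_lt j.+2 A <= size A by apply: count_size.
  by clear - e cj l1 l2 sAV tV'; lia.
have [t tB Bt] := nthP 0 jB; exists t; first by rewrite -sBV.
split=> // tV'; move/eqP: Bt; rewrite nth_eq_sorted // => /andP[_ /eqP cj].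
have := nth_ltn_sorted j.+2 sA; rewrite sAV => /(_ _ tV').
by rewrite jB in e; clear - e e1 cj; lia.
Qed.

End Valleys.

(** * Points of a path indexed by the number of steps taken *)

Definition npt (w : seq bool) (i : nat) : nat * nat :=
  (count negb (take i w), count id (take i w)).

Definition intpt (p : nat * nat) : int * int := (p.1%:Z, p.2%:Z)%R.

Lemma intpt_inj : injective intpt.
Proof. by move=> [a b] [c d] [-> ->]. Qed.

Lemma npt0 w : npt w 0 = (0, 0).
Proof. by rewrite /npt take0. Qed.

Lemma nptS w i : i < size w ->
  npt w i.+1 = if nth false w i then ((npt w i).1, (npt w i).2.+1)
               else ((npt w i).1.+1, (npt w i).2).
Proof.
move=> iw; rewrite /npt (take_nth false iw) -cats1 !count_cat /=.
by case: nth; rewrite /= !addn0 ?addn1.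
Qed.

Lemma npt_sum w i : i <= size w -> (npt w i).1 + (npt w i).2 = i.
Proof. by move=> iw; rewrite addnC (count_predC id) size_takel. Qed.

Lemma points_npt w : points w = [seq intpt (npt w i) | i <- iota 0 (size w).+1].
Proof.
(* The starting point is made arbitrary so that induction on the word applies. *)
suff scan p : scanl move (intpt p) w =
    [seq intpt (p.1 + (npt w i).1, p.2 + (npt w i).2) | i <- iota 1 (size w)].
  by rewrite /points /= (scan (0, 0)) npt0; congr cons.
elim: w p => //= s w IH p.
have -> : move (intpt p) s = intpt (p.1 + ~~ s, p.2 + s).
  by rewrite /move /intpt; case: s; congr pair => /=; lia.
rewrite IH /npt /= take0 /= !addn0; congr cons.
rewrite -[2]/(1 + 1) iotaDl -map_comp; apply: eq_map => i /=.
by rewrite /npt /= !addnA.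
Qed.

Lemma infix_nthP (T : eqType) (x0 : T) (u s : seq T) :
  reflect (exists2 k, k + size u <= size s &
             forall i, i < size u -> nth x0 s (k + i) = nth x0 u i)
          (infix u s).
Proof.
apply: (iffP idP) => [/infixP[p [q ->]]|[k kl h]].
  exists (size p); first by rewrite !size_cat; lia.
  by move=> i iu; rewrite nth_cat ltnNge leq_addr /= addKn nth_cat iu.
apply/infixP; exists (take k s), (drop (k + size u) s).
have -> : u = take (size u) (drop k s).
  apply: (@eq_from_nth _ x0) => [|i iu].
    by rewrite size_takel // size_drop; lia.
  by rewrite nth_take // nth_drop h.
by rewrite size_takel ?size_drop; [rewrite addnC -drop_drop !cat_take_drop|lia].
Qed.

Lemma nth_points w i : i <= size w -> nth (0, 0)%R (points w) i = intpt (npt w i).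
Proof.
by move=> iw; rewrite points_npt (nth_map 0) ?size_iota // nth_iota.
Qed.

Lemma size_points w : size (points w) = (size w).+1.
Proof. by rewrite points_npt size_map size_iota. Qed.

Lemma npt_index w i k : i <= size w -> k <= size w -> npt w i = npt w k -> i = k.
Proof. by move=> /npt_sum {2}<- /npt_sum {2}<- ->. Qed.

(** The coordinates of a point add up to its index, so each point occurs only once on the path. A
    pattern centred at point [i] can therefore only occupy the indices i - 1, i and i + 1. *)
Lemma infix3_points w q q' i : i <= size w ->
  infix [:: q; intpt (npt w i); q'] (points w) =
  [&& 0 < i, i < size w, intpt (npt w i.-1) == q & intpt (npt w i.+1) == q'].
Proof.
move=> iw; apply/(infix_nthP (0, 0)%R)/and4P => [[k]|[i0 iw' /eqP e1 /eqP e2]].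
  rewrite size_points addn3 ltnS => kw h.
  have := h 0 isT; have := h 1 isT; have := h 2 isT; rewrite /= addn0 addn1 addn2.
  rewrite !nth_points; try lia.
  move=> e2 /intpt_inj /npt_index e1 e0.
  have {}e1 : k.+1 = i by apply: e1; lia.
  by subst i => /=; rewrite e0 e2 !eqxx; split => //; lia.
exists i.-1; first by rewrite size_points /=; lia.
case=> [|[|[|//]]] _ /=; rewrite ?addn0 ?addn1 ?addn2 nth_points ?e1 ?prednK //; try lia.
Qed.

(** * Valleys, double rises and double falls read off pairs of consecutive steps *)

Definition nvalleys (w : seq bool) : seq (nat * nat) :=
  [seq npt w i.+1 | i <- iota 0 (size w).-1 & ~~ nth false w i && nth false w i.+1].

Definition nrises (w : seq bool) : seq nat :=
  [seq (npt w i.+1).2 | i <- iota 0 (size w).-1 & nth false w i && nth false w i.+1].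

Definition nfalls (w : seq bool) : seq nat :=
  [seq (npt w i.+1).1 | i <- iota 0 (size w).-1 & ~~ nth false w i && ~~ nth false w i.+1].

(** Here [Q i] is meant to describe the steps [i] and [i.+1], whose common point has index [i.+1].
    The guards discard the two endpoints of the path, which lie between no two steps. *)
Lemma filter_points w (P : pred (int * int)) (Q : pred nat) :
  (forall i, i <= size w ->
     P (intpt (npt w i)) = [&& 0 < i, i < size w & Q i.-1]) ->
  [seq p <- points w | P p] =
  [seq intpt (npt w i.+1) | i <- iota 0 (size w).-1 & Q i].
Proof.
move=> PQ; rewrite points_npt filter_map.
have -> : [seq i <- iota 0 (size w).+1 | preim (fun i => intpt (npt w i)) P i] =
   [seq i <- iota 0 (size w).+1 | [&& 0 < i, i < size w & Q i.-1]].
  by apply: eq_in_filter => i; rewrite mem_iota => /= iw; apply: PQ; lia.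
case: (size w) => [|n] //.
have -> : iota 0 n.+2 = 0 :: rcons (map S (iota 0 n)) n.+1.
  rewrite -cats1 -[LHS]/(0 :: iota 1 n.+1); congr cons.
  by rewrite -[n.+1 in LHS]addn1 (iotaD 1 n 1) (iotaDl 1 0) add1n.
rewrite /= filter_rcons ltnn andbF filter_map -map_comp.
congr map; apply: eq_in_filter => i; rewrite mem_iota /=.
by rewrite add0n ltnS => ->.
Qed.

Lemma valley_npt w i : i <= size w ->
  valley w (intpt (npt w i)).1 (intpt (npt w i)).2 =
  [&& 0 < i, i < size w & ~~ nth false w i.-1 && nth false w i].
Proof.
move=> iw; rewrite /valley -surjective_pairing infix3_points //.
case: i iw => // i iw; have [iw'|_] := ltnP i.+1 (size w); last by [].
rewrite (nptS iw') (nptS (ltnW iw')) -[i.+1.-1]/i /intpt; case: (npt w i) => x y.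
by case: (nth _ _ i.+1); case: (nth _ _ i); rewrite !xpair_eqE /=; lia.
Qed.

Lemma double_rise_npt w i : i <= size w ->
  double_rise w (intpt (npt w i)).1 (intpt (npt w i)).2 =
  [&& 0 < i, i < size w & nth false w i.-1 && nth false w i].
Proof.
move=> iw; rewrite /double_rise -surjective_pairing infix3_points //.
case: i iw => // i iw; have [iw'|_] := ltnP i.+1 (size w); last by [].
rewrite (nptS iw') (nptS (ltnW iw')) -[i.+1.-1]/i /intpt; case: (npt w i) => x y.
by case: (nth _ _ i.+1); case: (nth _ _ i); rewrite !xpair_eqE /=; lia.
Qed.

Lemma double_fall_npt w i : i <= size w ->
  double_fall w (intpt (npt w i)).1 (intpt (npt w i)).2 =
  [&& 0 < i, i < size w & ~~ nth false w i.-1 && ~~ nth false w i].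
Proof.
move=> iw; rewrite /double_fall -surjective_pairing infix3_points //.
case: i iw => // i iw; have [iw'|_] := ltnP i.+1 (size w); last by [].
rewrite (nptS iw') (nptS (ltnW iw')) -[i.+1.-1]/i /intpt; case: (npt w i) => x y.
by case: (nth _ _ i.+1); case: (nth _ _ i); rewrite !xpair_eqE /=; lia.
Qed.

Lemma valleysE w : valleys w = [seq intpt p | p <- nvalleys w].
Proof.
rewrite /valleys (@filter_points w (fun p => valley w p.1 p.2)
  (fun i => ~~ nth false w i && nth false w i.+1)).
  by rewrite /nvalleys -map_comp.
by move=> [|i] iw; rewrite valley_npt.
Qed.

Lemma risesE w : rises w = [seq (y%:Z)%R | y <- nrises w].
Proof.
rewrite /rises (@filter_points w (fun p => double_rise w p.1 p.2)
  (fun i => nth false w i && nth false w i.+1)).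
  by rewrite /nrises -!map_comp.
by move=> [|i] iw; rewrite double_rise_npt.
Qed.

Lemma fallsE w : falls w = [seq (x%:Z)%R | x <- nfalls w].
Proof.
rewrite /falls (@filter_points w (fun p => double_fall w p.1 p.2)
  (fun i => ~~ nth false w i && ~~ nth false w i.+1)).
  by rewrite /nfalls -!map_comp.
by move=> [|i] iw; rewrite double_fall_npt.
Qed.

Lemma zip_rises_falls w :
  zip (rises w) (falls w) = [seq intpt p | p <- zip (nrises w) (nfalls w)].
Proof.
rewrite risesE fallsE; elim: (nrises w) (nfalls w) => [|x r IH] [|y f] //=.
by rewrite IH.
Qed.

(** * Enumerating horizontal and vertical steps by their coordinates *)

Lemma leq_npt w i k : i <= k ->
  (npt w i).1 <= (npt w k).1 /\ (npt w i).2 <= (npt w k).2.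
Proof.
move=> ik; rewrite /npt -(cat_take_drop i (take k w)) take_takel //.
by rewrite !count_cat !leq_addr.
Qed.

(** Successive horizontal steps start at the ordinates 0, 1, 2, and so on. The first step of the
    word is split off because no step precedes it. *)
Lemma iota_ntrue w m : m < size w ->
  iota 0 (npt w m.+1).2 =
  iota 0 (npt w 1).2 ++ [seq (npt w i.+1).2 | i <- iota 0 m & nth false w i.+1].
Proof.
elim: m => [|m IH] mw; first by rewrite cats0.
rewrite (nptS mw) -[in RHS](addn1 m) (iotaD 0 m 1) filter_cat map_cat catA -IH ?(ltnW mw) //.
rewrite add0n /=; case: (nth _ _ _); last by rewrite cats0.
by have := iotaD 0 (npt w m.+1).2 1; rewrite addn1.
Qed.

(** Successive vertical steps end at the abscissas 1, 2, 3, and so on. *)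
Lemma iota_nfalse w m : m <= size w ->
  iota 1 (npt w m).1 = [seq (npt w i.+1).1 | i <- iota 0 m & ~~ nth false w i].
Proof.
elim: m => [|m IH] mw; first by rewrite npt0.
rewrite -[in RHS](addn1 m) (iotaD 0 m 1) filter_cat map_cat -IH ?(ltnW mw) //.
have -> : [seq (npt w i.+1).1 | i <- iota (0 + m) 1 & ~~ nth false w i] =
    if nth false w m then [::] else [:: (npt w m.+1).1] by rewrite /=; case: nth.
rewrite (nptS mw); case: (nth _ _ _); first by rewrite cats0.
by have := iotaD 1 (npt w m).1 1; rewrite addn1.
Qed.

Lemma perm_map_filterC (T : Type) (U : eqType) (F : T -> U) (a b : pred T) (s : seq T) :
  perm_eq ([seq F x | x <- s & a x && b x] ++ [seq F x | x <- s & ~~ a x && b x])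
          [seq F x | x <- s & b x].
Proof.
elim: s => //= x s IH; case: (a x); case: (b x) => //=.
  by rewrite perm_cons.
by rewrite -cat1s perm_catCA perm_cons.
Qed.

Lemma sorted_map_filterI (T : Type) (F : T -> nat) (a b : pred T) (s : seq T) :
  sorted ltn [seq F x | x <- s & b x] -> sorted ltn [seq F x | x <- s & a x && b x].
Proof.
apply: (subseq_sorted ltn_trans); elim: s => //= x s IH.
case: (a x); case: (b x) => //=; first by rewrite eqxx.
by case: [seq F x | x <- s & b x] IH => [|y t] IH //; apply: subseq_trans IH (subseq_cons _ _).
Qed.

(** * Dyck words: their steps, valleys, returns and hills *)

Section DyckWord.

Variables (N : nat) (w : seq bool).
Hypotheses (sw : size w = N.*2) (dw : is_dyck N w).

Lemma npt_le i : i <= size w -> (npt w i).1 <= (npt w i).2.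
Proof.
move=> iw; move: dw => /andP[_ /allP /(_ (intpt (npt w i)))].
rewrite -nth_points // mem_nth ?size_points // => /(_ isT).
by rewrite nth_points.
Qed.

Lemma npt_size : npt w (size w) = (N, N).
Proof.
move: dw => /andP[/eqP + _]; rewrite -nth_last size_points nth_points //.
by move=> e; apply: intpt_inj.
Qed.

Lemma npt_1 : 0 < N -> npt w 1 = (0, 1).
Proof.
move=> N0; have w0 : 0 < size w by rewrite sw; lia.
have := npt_le w0; rewrite (nptS w0) npt0; case: nth => //=.
Qed.

Lemma npt_pred : 0 < N -> npt w (size w).-1 = (N.-1, N).
Proof.
move=> N0; have w0 : 0 < size w by rewrite sw; lia.
have lw : (size w).-1 < size w by rewrite prednK.
have := npt_le (leq_pred (size w)); have := nptS lw.
rewrite prednK // npt_size; case: (npt w _.-1) => x y; case: nth => /= -[Nx Ny] xy.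
  by lia.
by rewrite {1}Nx Ny.
Qed.

(** A nonempty Dyck path opens with a horizontal step, starting at ordinate 0; the other ones start
    at 1, ..., N-1. *)
Lemma all_true_steps :
  [seq (npt w i.+1).2 | i <- iota 0 (size w).-1 & nth false w i.+1] = iota 1 N.-1.
Proof.
case: (posnP N) => [N0|N0]; first by rewrite sw N0.
have w0 : 0 < size w by rewrite sw; lia.
have lw : (size w).-1 < size w by rewrite prednK.
have := iota_ntrue lw; rewrite prednK // npt_size npt_1 //=.
by rewrite -{1}(prednK N0) /= => -[->].
Qed.

(** A nonempty Dyck path closes with a vertical step, ending at abscissa N; the other ones end at 1,
    ..., N-1. *)
Lemma all_false_steps :
  [seq (npt w i.+1).1 | i <- iota 0 (size w).-1 & ~~ nth false w i] = iota 1 N.-1.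
Proof.
case: (posnP N) => [N0|N0]; first by rewrite sw N0.
by rewrite -iota_nfalse ?leq_pred // npt_pred.
Qed.

Lemma unzip2_nvalleys : unzip2 (nvalleys w) =
  [seq (npt w i.+1).2 | i <- iota 0 (size w).-1 & ~~ nth false w i && nth false w i.+1].
Proof. by rewrite /unzip2 -map_comp. Qed.

Lemma unzip1_nvalleys : unzip1 (nvalleys w) =
  [seq (npt w i.+1).1 | i <- iota 0 (size w).-1 & nth false w i.+1 && ~~ nth false w i].
Proof.
by rewrite /unzip1 -map_comp; congr map; apply: eq_filter => i; rewrite andbC.
Qed.

Lemma nfallsE : nfalls w =
  [seq (npt w i.+1).1 | i <- iota 0 (size w).-1 & ~~ nth false w i.+1 && ~~ nth false w i].
Proof. by congr map; apply: eq_filter => i; rewrite andbC. Qed.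

(** A horizontal step other than the first follows either a vertical step, at a valley, or a
    horizontal one, at a double rise. *)
Lemma perm_valleys_rises : perm_eq (unzip2 (nvalleys w) ++ nrises w) (iota 1 N.-1).
Proof. by rewrite unzip2_nvalleys -all_true_steps perm_catC perm_map_filterC. Qed.

(** A vertical step other than the last precedes either a horizontal step, at a valley, or a
    vertical one, at a double fall. *)
Lemma perm_valleys_falls : perm_eq (unzip1 (nvalleys w) ++ nfalls w) (iota 1 N.-1).
Proof. by rewrite unzip1_nvalleys nfallsE -all_false_steps perm_map_filterC. Qed.

Lemma sorted_valleys1 : sorted ltn (unzip1 (nvalleys w)).
Proof.
by rewrite unzip1_nvalleys sorted_map_filterI // all_false_steps iota_ltn_sorted.
Qed.

Lemma sorted_valleys2 : sorted ltn (unzip2 (nvalleys w)).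
Proof.
by rewrite unzip2_nvalleys sorted_map_filterI // all_true_steps iota_ltn_sorted.
Qed.

Lemma sorted_rises : sorted ltn (nrises w).
Proof. by rewrite sorted_map_filterI // all_true_steps iota_ltn_sorted. Qed.

Lemma sorted_falls : sorted ltn (nfalls w).
Proof. by rewrite nfallsE sorted_map_filterI // all_false_steps iota_ltn_sorted. Qed.

Lemma uniq_nvalleys : uniq (nvalleys w).
Proof.
apply: (@map_uniq _ _ fst).
by have := sorted_valleys1; rewrite ltn_sorted_uniq_leq => /andP[].
Qed.

Lemma valleys_le : all (fun v => v.1 <= v.2) (nvalleys w).
Proof.
apply/allP => _ /mapP[i + ->]; rewrite mem_filter mem_iota => iw.
by apply: npt_le; clear - iw; lia.
Qed.

(** The point (p, p) can only have index 2p. Staying weakly above the diagonal forces a vertical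
    step into it and a horizontal step out of it. *)
Lemma mem_nvalleys_diag p : 0 < p < N ->
  ((p, p) \in nvalleys w) = (npt w p.*2 == (p, p)).
Proof.
move=> pN; apply/mapP/eqP => [[i]|e].
  rewrite mem_filter mem_iota => /andP[_ iw] e.
  have {}iw : i.+1 <= size w by lia.
  have := npt_sum iw; rewrite -e /= addnn => ->; exact: esym.
have i1 : p.*2.-1 < size w by lia.
have i2 : p.*2 < size w by lia.
have e' : p.*2.-1.+1 = p.*2 by lia.
exists p.*2.-1; last by rewrite e'.
have := npt_le i2; rewrite (nptS i2); have := npt_le (ltnW i1); have := nptS i1.
rewrite mem_filter mem_iota e' e.
case: (npt w p.*2.-1) => x y; case: (nth _ _ p.*2.-1) => /= -[ex ey] xy.
  by lia.
by case: (nth _ _ _) => /=; lia.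
Qed.

Lemma return_atP j : return_at w (j + 1)%R <->
  exists2 p : nat, j = (p%:Z)%R & p < N /\ npt w p.+1.*2 = (p.+1, p.+1).
Proof.
split=> [/(infix_nthP (0, 0)%R) [k]|[p -> [pN e]]].
  rewrite size_points /= addn2 ltnS => kw h.
  have := h 0 isT; have := h 1 isT; rewrite addn0 addn1 !nth_points ?(ltnW kw) //=.
  have := npt_sum kw; have := leq_npt w kw; rewrite npt_size => -[].
  case e1 : (npt w k.+1) => [x y] /= xN yN kE.
  rewrite /intpt => -[/= ex ey] -[ex' ey'].
  have ? : y = x by lia.
  have [p ?] : exists p, x = p.+1 by exists x.-1; lia.
  subst y x; exists p; first by lia.
  by split=> //; rewrite -addnn kE.
have i1 : p.*2.+1 < size w by lia.
apply/(infix_nthP (0, 0)%R); exists p.*2.+1; first by rewrite size_points /=; lia.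
have := npt_le (ltnW i1); have := nptS i1; rewrite -[p.*2.+2]/(p.+1.*2) e.
case e1 : (npt w p.*2.+1) => [x y] e2 xy.
(* The other possible predecessor, (p + 1, p), lies below the diagonal. *)
have [ex ey] : x = p /\ y = p.+1.
  by move: e2 xy; case: nth => /= -[ex ey] xy; lia.
case=> [|[|//]] _; rewrite ?addn0 ?addn1 nth_points ?(ltnW i1) //=.
  by rewrite e1 ex ey /intpt; congr pair => /=; lia.
by rewrite -[p.*2.+2]/(p.+1.*2) e /intpt; congr pair => /=; lia.
Qed.

(** Between contacts at p and p + 1 there are only two steps, and a vertical step from (p, p) would
    leave the region. *)
Lemma ends_one_hillP p : p < N -> npt w p.+1.*2 = (p.+1, p.+1) ->
  ends_one_hill w (p%:Z + 1)%R <-> npt w p.*2 = (p, p).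
Proof.
move=> pN e; have i1 : p.*2 < size w by lia.
split=> [[q /(infix_nthP (0, 0)%R) [k]]|e'].
  rewrite size_points /= addn3 ltnS => kw h qE.
  have kw' : k <= size w by lia.
  have := h 0 isT; rewrite addn0 nth_points //= => ek.
  have := npt_sum kw'; case ek' : (npt w k) ek => [x y]; rewrite /intpt => -[/= ex ey] kE.
  have [? ?] : x = p /\ y = p by lia.
  by subst x y; rewrite -addnn kE.
exists (p%:Z)%R => //.
apply/(infix_nthP (0, 0)%R); exists p.*2; first by rewrite size_points /=; lia.
have e1 : npt w p.*2.+1 = (p, p.+1).
  by have := npt_le i1; rewrite (nptS i1) e'; case: nth => //=; lia.
case=> [|[|[|//]]] _; rewrite ?addn0 ?addn1 ?addn2 nth_points ?e' ?e1 //=; try lia.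
  by rewrite /intpt; congr pair => /=; lia.
by rewrite -[p.*2.+2]/(p.+1.*2) e /intpt; congr pair => /=; lia.
Qed.

End DyckWord.

(** * Building a Dyck path with prescribed valleys *)

Fixpoint valleys_from (x y : nat) (w : seq bool) : seq (nat * nat) :=
  match w with
  | [::] => [::]
  | true :: w' => valleys_from x y.+1 w'
  | false :: w' =>
      if head false w' then (x.+1, y) :: valleys_from x.+1 y w'
      else valleys_from x.+1 y w'
  end.

Lemma nvalleys_from w : nvalleys w = valleys_from 0 0 w.
Proof.
(* The sum runs over all indices below [size w], which suits the induction. The extra last index
   yields no valley, as the default step past the end is [false]. *)
suff gen x y : valleys_from x y w =
    [seq (x + (npt w i.+1).1, y + (npt w i.+1).2)
       | i <- iota 0 (size w) & ~~ nth false w i && nth false w i.+1].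
  rewrite gen /nvalleys; case: w {gen} => // s w.
  rewrite [size _]/= -[(size w).+1]addn1 iotaD filter_cat map_cat.
  rewrite [filter _ (iota (0 + _) 1)]/= (nth_default false (leqnn (size w))) andbF cats0.
  by rewrite addn1; apply: eq_map => i; rewrite -surjective_pairing.
elim: w x y => // s w IH x y.
have -> : iota 0 (size (s :: w)) = [:: 0] ++ map S (iota 0 (size w)).
  by rewrite -(iotaDl 1 0).
rewrite filter_cat map_cat filter_map -map_comp.
rewrite (_ : map _ [seq i <- iota 0 (size w) | _] =
             valleys_from (x + ~~ s) (y + s) w); last first.
  by rewrite IH; apply: eq_map => i; rewrite /npt /= !addnA.
case: s; rewrite /= ?nth0 ?addn0 ?addn1 //.
by case: (head _ _); rewrite /= ?take0 /= ?addn0 ?addn1.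
Qed.

(** Like [valleys_from], this reads a word from an arbitrary point, so that it can be evaluated run
    by run on concatenations. Only vertical steps can cross the diagonal. *)
Fixpoint dyck_from (N x y : nat) (w : seq bool) : bool :=
  match w with
  | [::] => (x == N) && (y == N)
  | true :: w' => dyck_from N x y.+1 w'
  | false :: w' => (x < y) && dyck_from N x.+1 y w'
  end.

Lemma is_dyck_from N w : dyck_from N 0 0 w -> is_dyck N w.
Proof.
suff gen x y : x <= y -> dyck_from N x y w ->
    let s := intpt (x, y) :: scanl move (intpt (x, y)) w in
    (last (0, 0)%R s == intpt (N, N)) && all (fun p => p.1 <= p.2)%R s.
  by move=> /gen -/(_ (leq0n _)).
elim: w x y => [|s w IH] x y xy /=.
  by move=> /andP[/eqP-> /eqP->]; rewrite eqxx lexx.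
have -> : move (intpt (x, y)) s = intpt (x + ~~ s, y + s).
  by rewrite /move /intpt; case: s; congr pair => /=; lia.
move: (IH (x + ~~ s) (y + s)); case: s; rewrite /= ?addn0 ?addn1 => {}IH.
  move=> /(IH (leqW xy)) /= /andP[-> /= ->].
  by rewrite andbT; lia.
move=> /andP[xy' /(IH xy') /= /andP[-> /= ->]].
by rewrite andbT; lia.
Qed.

Lemma size_dyck_from N x y w : dyck_from N x y w -> x + y + size w = N.*2.
Proof.
elim: w x y => [|[] w IH] x y /=.
- by move=> /andP[/eqP-> /eqP->]; rewrite addn0 addnn.
- by move=> /IH <-; lia.
by move=> /andP[_ /IH <-]; lia.
Qed.

Fixpoint word_of_valleys (N x y : nat) (Z : seq (nat * nat)) : seq bool :=
  match Z with
  | [::] => nseq (N - y) true ++ nseq (N - x) false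
  | v :: Z' =>
      nseq (v.2 - y) true ++ nseq (v.1 - x) false ++ word_of_valleys N v.1 v.2 Z'
  end.

(** Strict increase makes every run between valleys nonempty, and ordinates below N leave a
    horizontal step after the last valley. *)
Definition valley_chain (N x y : nat) (Z : seq (nat * nat)) : bool :=
  [&& path ltn x (unzip1 Z), path ltn y (unzip2 Z),
      all (fun v => v.1 <= v.2) Z & all (fun v => v.2 < N) Z].

Lemma valleys_from_nseq_true x y a w :
  valleys_from x y (nseq a true ++ w) = valleys_from x (y + a) w.
Proof. by elim: a y => [|a IH] y /=; rewrite ?addn0 // IH addSnnS. Qed.

Lemma valleys_from_nseq_false x y a : valleys_from x y (nseq a false) = [::].
Proof. by elim: a x => [|a IH] x //=; rewrite IH; case: a {IH}. Qed.

Lemma valleys_from_valley x y a w : head false w ->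
  valleys_from x y (nseq a.+1 false ++ w) = (x + a.+1, y) :: valleys_from (x + a.+1) y w.
Proof.
move=> w0; elim: a x => [|a IH] x; first by rewrite /= w0 addn1.
transitivity (valleys_from x.+1 y (nseq a.+1 false ++ w)); first by [].
by rewrite IH addSnnS.
Qed.

Lemma dyck_from_nseq_true N x y a w :
  dyck_from N x y (nseq a true ++ w) = dyck_from N x (y + a) w.
Proof. by elim: a y => [|a IH] y /=; rewrite ?addn0 // IH addSnnS. Qed.

Lemma dyck_from_nseq_false N x y a w : x + a <= y ->
  dyck_from N x y (nseq a false ++ w) = dyck_from N (x + a) y w.
Proof.
elim: a x => [|a IH] x xy /=; first by rewrite addn0.
by rewrite IH ?addSnnS //; lia.
Qed.

Lemma head_word_of_valleys N x y Z : y < N -> valley_chain N x y Z ->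
  head false (word_of_valleys N x y Z).
Proof.
case: Z => [|v Z] /= yN; first by case: (N - y) (subn_gt0 y N) => //=; rewrite yN.
move=> /and4P[_ /= /andP[yv _] _ _].
by case: (v.2 - y) (subn_gt0 y v.2) => //=; rewrite yv.
Qed.

Lemma word_of_valleysP N x y Z : x <= y -> y <= N -> valley_chain N x y Z ->
  valleys_from x y (word_of_valleys N x y Z) = Z /\
  dyck_from N x y (word_of_valleys N x y Z).
Proof.
elim: Z x y => [|[r f] Z IH] x y xy yN /=.
  move=> _; rewrite valleys_from_nseq_true valleys_from_nseq_false.
  rewrite dyck_from_nseq_true -[nseq (N - x) _]cats0 dyck_from_nseq_false; last by lia.
  by rewrite !subnKC ?(leq_trans xy yN) //= eqxx.
move=> /and4P[/= /andP[xr c1] /andP[yf c2] /andP[rf c3] /andP[fN c4]].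
have cZ : valley_chain N r f Z by apply/and4P.
have [IH1 IH2] := IH r f rf (ltnW fN) cZ.
rewrite valleys_from_nseq_true dyck_from_nseq_true subnKC 1?ltnW //.
(* The run of vertical steps is nonempty, since x < r, and hence ends in a valley. *)
have -> : r - x = (r - x).-1.+1 by lia.
rewrite valleys_from_valley ?head_word_of_valleys // dyck_from_nseq_false; last by lia.
have -> : x + (r - x).-1.+1 = r by lia.
by rewrite IH1.
Qed.

Lemma exists_dyck_valleys N Z : valley_chain N 0 0 Z ->
  exists E : dyck N, nvalleys E = Z.
Proof.
move=> /(word_of_valleysP (leqnn 0) (leq0n N)) [vZ dZ].
have /eqP sZ := size_dyck_from dZ.
by exists (@Dyck N (Tuple sZ) (is_dyck_from dZ)); rewrite nvalleys_from.
Qed.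

(** * Rectangles and heights in terms of indices *)

Lemma rectangleP w x y : uniq (nvalleys w) -> rectangle w x y <->
  exists2 t, t < size (nvalleys w) &
    intpt (nth (0, 0) (nvalleys w) t) = (x, y) /\
    (t.+1 < size (nvalleys w) ->
     (nth 0 (unzip2 (nvalleys w)) t).+1 < nth 0 (unzip1 (nvalleys w)) t.+1).
Proof.
set V := nvalleys w => uV.
have memV p : valley w p.1 p.2 = (p \in [seq intpt q | q <- V]).
  rewrite -valleysE mem_filter; case: (boolP (valley _ _ _)) => //= /mem_infix -> //.
  by rewrite !inE -surjective_pairing eqxx orbT.
have sV : size (valleys w) = size V by rewrite valleysE size_map.
have nthV t : t < size V -> nth (0, 0)%R (valleys w) t = intpt (nth (0, 0) V t).
  by move=> tV; rewrite valleysE (nth_map (0, 0)).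
have n2 t : t < size V -> nth 0 (unzip2 V) t = (nth (0, 0) V t).2.
  by move=> tV; rewrite (nth_map (0, 0)).
have n1 t : t < size V -> nth 0 (unzip1 V) t = (nth (0, 0) V t).1.
  by move=> tV; rewrite (nth_map (0, 0)).
split=> [[v nv]|[t tV [et nt]]].
  move: v; rewrite (memV (x, y)) => /mapP[q /(nthP (0, 0))[t tV qt] e].
  exists t => //; split; first by rewrite qt e.
  move=> tV'; rewrite n2 // n1 // qt.
  have /nv : next_valley w (x, y) (intpt (nth (0, 0) V t.+1)).
    apply/(infix_nthP (0, 0)%R); exists t; first by rewrite sV addn2.
    by case=> [|[|//]] _; rewrite ?addn0 ?addn1 nthV // qt e.
  by move: e => [_ ->] /=; lia.
split; first by rewrite (memV (x, y)) -et map_f // mem_nth.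
move=> x' y' /(infix_nthP (0, 0)%R)[k]; rewrite sV addn2 => kV h.
have := h 0 isT; have := h 1 isT; rewrite addn0 addn1 !nthV ?(ltnW kV) //= => e1.
(* Valleys being distinct, the occurrence found by [next_valley] is the one at index [t]. *)
rewrite -et => /intpt_inj /eqP; rewrite nth_uniq ?(ltnW kV) // => /eqP ?; subst k.
have := nt kV; rewrite n2 ?(ltnW kV) // n1 //.
by move: e1 et => [<- _] [_ <-] /=; lia.
Qed.

(** The vertical step of the valley leaves (x, y). Earlier points have ordinate at most y, and later
    ones have abscissa at least x + 1. *)
Lemma height_before_valley w x y : valley w (x + 1)%R y -> height w x = y.
Proof.
move=> /(infix_nthP (0, 0)%R)[k]; rewrite size_points /= addn3 ltnS => kw h.
have kw1 : k < size w by lia.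
have := h 0 isT; have := h 1 isT; rewrite addn0 addn1 !nth_points ?(ltnW kw1) //=.
case e1 : (npt w k.+1) => [a1 b1]; case e0 : (npt w k) => [a b] [E1 E2] [E3 E4].
apply/eqP; rewrite eq_le; apply/andP; split.
  rewrite /height big_seq_cond.
  (* The default 0 of the maximum respects the bound, as y is an ordinate of the path. *)
  apply: (big_ind (fun z => z <= y)%R); first by lia.
    by move=> u v uy vy; rewrite ge_max uy.
  move=> p /andP[]; rewrite points_npt => /mapP[m _ ->] /= /eqP mx.
  have [mk|km] := leqP m k; first by have [_] := leq_npt w mk; rewrite e0 /=; lia.
  by have [] := leq_npt w km; rewrite e1 /=; lia.
apply: (@bigmax_sup_seq _ _ _ _ _ (intpt (npt w k))).
- by rewrite -nth_points ?mem_nth ?size_points // ltnW.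
- by rewrite e0 /=; lia.
by rewrite e0 /=; lia.
Qed.

(** * The involution and the equivalence *)

Lemma LK_valleys N (D : dyck N) :
  perm_eq (nvalleys (LK D)) (zip (nrises D) (nfalls D)).
Proof.
apply: (@perm_map_inj _ _ intpt); first exact: intpt_inj.
(* The default branch of [LK] is refuted by exhibiting a path whose valleys are the pairs (r_t,
   f_t). *)
rewrite -valleysE -zip_rises_falls /LK; case: pickP => // noE.
have dD : is_dyck N D by case: (D).
have sD : size D = N.*2 by rewrite size_tuple.
have Br := perm_valleys_rises sD dD; have Af := perm_valleys_falls sD dD.
have srf := size_rises_falls Br Af.
suff /exists_dyck_valleys [E vE] : valley_chain N 0 0 (zip (nrises D) (nfalls D)).
  by have := noE E; rewrite valleysE zip_rises_falls vE perm_refl.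
have le_rf := rises_le_falls Br Af (sorted_rises sD dD) (sorted_falls sD dD) (valleys_le dD).
have path0 s : sorted ltn s -> (forall x, x \in s -> 0 < x < N) -> path ltn 0 s.
  by case: s => //= x s -> /(_ x (mem_head x s)) /andP[->].
apply/and4P; split.
- rewrite unzip1_zip ?srf //; apply: path0; first exact: sorted_rises sD dD.
  exact: complement_range Br.
- rewrite unzip2_zip ?srf //; apply: path0; first exact: sorted_falls sD dD.
  exact: complement_range Af.
- apply/(all_nthP (0, 0)) => t; rewrite size_zip srf minnn => tr.
  by rewrite nth_zip //= le_rf // srf.
apply/(all_nthP (0, 0)) => t; rewrite size_zip srf minnn => tf.
by rewrite nth_zip //=; have /andP[] := complement_range Af (mem_nth 0 tf).
Qed.

Lemma diagonal_LK N (D : dyck N) p : p <= N ->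
  npt (LK D) p.*2 = (p, p) <-> diagonal N (nrises D) (nfalls D) p.
Proof.
move=> pN; have dE : is_dyck N (LK D) by case: (LK D).
have sE : size (LK D) = N.*2 by rewrite size_tuple.
rewrite /diagonal; have [->|p0] := eqVneq p 0; first by rewrite npt0.
have [->|pN'] := eqVneq p N; first by have := npt_size dE; rewrite sE.
rewrite /= -(perm_mem (LK_valleys D)) (mem_nvalleys_diag sE dE) ?lt0n ?p0 ?ltn_neqAle ?pN' //.
by split=> [->|/eqP].
Qed.

Lemma rectangle_iff_return N (D : dyck N) (j : int) :
  ((exists i : int, rectangle D (i + 1) j) <->
   (return_at (LK D) (j + 1) /\ ~ ends_one_hill (LK D) (j + 1)))%R.
Proof.
have dD : is_dyck N D by case: (D).
have sD : size D = N.*2 by rewrite size_tuple.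
have dE : is_dyck N (LK D) by case: (LK D).
have sE : size (LK D) = N.*2 by rewrite size_tuple.
have uV := uniq_nvalleys sD dD.
have key := rectangle_diagonal (perm_valleys_rises sD dD) (perm_valleys_falls sD dD)
  (sorted_valleys1 sD dD) (sorted_valleys2 sD dD)
  (sorted_rises sD dD) (sorted_falls sD dD) (valleys_le dD).
split=> [[i /(rectangleP _ _ uV) [t tV [et nt]]]|[]].
  have nb : nth 0 (unzip2 (nvalleys D)) t = (nth (0, 0) (nvalleys D) t).2.
    by rewrite (nth_map (0, 0)).
  have [|pN d1 /negP d0] := (key (nth (0, 0) (nvalleys D) t).2).1.
    by exists t => //; rewrite -nb.
  have -> : j = ((nth (0, 0) (nvalleys D) t).2%:Z)%R by case: et.
  have e1 := (diagonal_LK D pN).2 d1.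
  split; first by apply/(return_atP sE dE); eexists; first by [].
  by move=> /(ends_one_hillP sE dE pN e1) /(diagonal_LK D (ltnW pN)).
move=> /(return_atP sE dE) [p -> [pN e1]] nh.
have [|t tV [nb nt]] := (key p).2.
  split=> //; first exact/(diagonal_LK D pN).
  by apply/negP => /(diagonal_LK D (ltnW pN)) /(ends_one_hillP sE dE pN e1).
(* A rectangle at (i + 1, j) has its valley at abscissa i + 1, whence i = a_t - 1. *)
exists ((nth (0, 0) (nvalleys D) t).1%:Z - 1)%R.
apply/(rectangleP _ _ uV); exists t => //; split; last by rewrite nb.
move: nb; rewrite (nth_map (0, 0)) // => <-.
by rewrite /intpt subrK.
Qed.

Local Open Scope ring_scope.

Theorem theorem3p14 (N : nat) (D : dyck N) (j : int) :
  ((exists i : int, rectangle D (i + 1) j) <->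
   (return_at (LK D) (j + 1) /\ ~ ends_one_hill (LK D) (j + 1))) /\
  (forall i : int, rectangle D (i + 1) j -> j + 1 = i + area D i).
Proof.
split; first exact: rectangle_iff_return.
(* The valley at (i + 1, j) gives h_i = j, so i + c_i = i + (j - i + 1) = j + 1. *)
by move=> i [/height_before_valley h _]; rewrite /area h addrA addrCA subrr addr0.
Qed.
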